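(* For every integer $l\geq 1$ and every integer $n\geq 0$, \[ \Delta_2\!\left(3^{2l+1}n+\tfrac{3}{4}(3^{2l}-1)+3^{2l}+1\right)\equiv 0 \pmod{3} \] and \[ \Delta_2\!\left(3^{2l+1}n+\tfrac{3}{4}(3^{2l}-1)+2\cdot 3^{2l}+1\right)\equiv 0 \pmod{3}. \] (For example, $\Delta_2(27n+16)\equiv\Delta_2(27n+25)\equiv 0$ and $\Delta_2(243n+142)\equiv\Delta_2(243n+223)\equiv 0 \pmod 3$.)
   Context: $\Delta_2(n)$ denotes the number of broken $2$-diamond partitions of $n$ (in the sense of Andrews and Paule). Equivalently, $\Delta_2(n)$ is determined by the generating function identity \[ \sum_{n\geq 0}\Delta_2(n)q^n=\frac{(-q;q)_\infty}{(q;q)_\infty^2\,(-q^{5};q^{5})_\infty}, \] where $(a;q)_\infty=\prod_{j\geq 0}(1-aq^j)$. Note $\tfrac34(3^{2l}-1)$ is an integer. *)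

(* Defs.v *)
From HB Require Import structures.
From mathcomp Require Import all_boot all_order all_algebra.

Set Implicit Arguments.
Unset Strict Implicit.
Unset Printing Implicit Defensive.

Import GRing.Theory.
Local Open Scope ring_scope.

(* A formal power series over the integers is given by its coefficients. *)
Definition fps := nat -> int.

Definition fps_mul (f g : fps) : fps :=
  fun n => \sum_(i < n.+1) f i * g (n - i)%N.

(* The list of the first n coefficients of f / g, obtained by solving
   fps_mul h g = f for h; see fps_divK. Meaningful when g 0 = 1. *)
Fixpoint fps_div_seq (f g : fps) (n : nat) : seq int :=
  if n is m.+1 then
    let s := fps_div_seq f g m in
    rcons s (f m - \sum_(i < m) s`_i * g (m - i)%N)
  else [::].

Definition fps_div (f g : fps) : fps := fun n => (fps_div_seq f g n.+1)`_n.

(* (a;b)_oo = \prod_(j >= 0) (1 - a b^j), the variable q being 'X. When b has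
   zero constant term, the factors with j > n do not affect the coefficient
   of q^n; see qpoch_stable. *)
Definition qpoch (a b : {poly int}) : fps :=
  fun n => (\prod_(j < n.+1) (1 - a * b ^+ j))`_n.

(* The number of broken 2-diamond partitions of n, through the generating
   function of Andrews and Paule. *)
Definition Delta2 : fps :=
  fps_div (qpoch (- 'X) 'X)
          (fps_mul (fps_mul (qpoch 'X 'X) (qpoch 'X 'X))
                   (qpoch (- 'X^5) 'X^5)).

Lemma qpoch_stable (a b : {poly int}) (n N : nat) :
  b`_0 = 0 -> (n <= N)%N ->
  (\prod_(j < N.+1) (1 - a * b ^+ j))`_n = qpoch a b n.
Proof.
move=> b0; have [c ->] : exists c, b = c * 'X.
  exists (drop_poly 1 b); rewrite -[LHS](poly_take_drop 1) expr1.
  suff -> : take_poly 1 b = 0 by rewrite add0r.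
  by apply/polyP => -[|i]; rewrite coef_take_poly coef0.
elim: N => [|N IHN]; first by rewrite leqn0 => /eqP ->.
rewrite leq_eqVlt => /predU1P[-> //|lt_nN].
rewrite big_ord_recr /= mulrBr mulr1 coefB IHN //.
by rewrite exprMn !mulrA coefMXn lt_nN subr0.
Qed.

Lemma size_fps_div_seq (f g : fps) n : size (fps_div_seq f g n) = n.
Proof. by elim: n => //= n IHn; rewrite size_rcons IHn. Qed.

Lemma nth_fps_div_seq (f g : fps) n i :
  (i < n)%N -> (fps_div_seq f g n)`_i = fps_div f g i.
Proof.
elim: n => // n IHn; rewrite ltnS leq_eqVlt => /predU1P[-> //|lt_in].
by rewrite /= nth_rcons size_fps_div_seq lt_in IHn.
Qed.

Lemma fps_divK (f g : fps) : g 0%N = 1 -> fps_mul (fps_div f g) g =1 f.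
Proof.
move=> g0 n; rewrite /fps_mul big_ord_recr /= subnn g0 mulr1.
rewrite {2}/fps_div /= nth_rcons size_fps_div_seq ltnn eqxx.
under [X in _ + (_ - X)]eq_bigr => i _ do rewrite nth_fps_div_seq //.
by rewrite addrC subrK.
Qed.

Lemma Delta2_gf :
  fps_mul Delta2 (fps_mul (fps_mul (qpoch 'X 'X) (qpoch 'X 'X))
                          (qpoch (- 'X^5) 'X^5))
  =1 qpoch (- 'X) 'X.
Proof.
apply: fps_divK; rewrite /fps_mul /qpoch !big_ord_recl !big_ord0 /= !addr0 !mulr1.
by rewrite !coefB coefN coefX coefXn coef1.
Qed.

(* Main.v *)
Require Import Defs.
From HB Require Import structures.
From mathcomp Require Import all_boot all_order all_algebra.
From mathcomp Require Import boolp classical_sets functions cardinality fsbigop.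
From mathcomp Require Import finfield ring zify.

(** Write f_k = (q^k;q^k)_oo and let phi = f_1^2/f_2 and psi = f_2^2/f_1 be the
    theta functions sum (-1)^n q^(n^2) and sum q^(n(n+1)/2).  Modulo 3 the
    generating function is g = f_2 f_5 / (f_1^3 f_10).  The main point is
      sum Delta2(3m+1) q^m = - q psi(q^5)^2   (mod 3),
    which, with D = q d/dq over F_3, is the differential equation
    D^2 g + D g = q^4 psi(q^5)^6.  In characteristic 3 the theta functions satisfy
    D phi = phi - phi^9 and D psi = q psi^9, and g is, up to cubes, a monomial in
    phi(q), phi(q^5) and p = psi(q)^2 - q psi(q^5)^2 = f_2 f_5^3 / (f_1 f_10).  So
    D g / g is a polynomial in the theta functions, and the level 10 relations
    express everything through u = q psi(q^5)^2 / p and phi(q^5)^8.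
    The two level 10 relations come from splitting Z[i] into the ideal (2 + i) and
    its four other cosets, which multiplication by i permutes, and from the Jacobi
    triple product.  Finally 8t + 2 is a sum of two squares whenever psi^2 has a
    nonzero coefficient at q^t, and the 3-adic valuation of such a sum is even. *)

Set Implicit Arguments.
Unset Strict Implicit.
Unset Printing Implicit Defensive.

Import GRing.Theory.
Local Open Scope ring_scope.

(** * Formal power series *)

Definition series (R : Type) := nat -> R.

Section SeriesRing.
Variable R : comNzRingType.
Implicit Types f g h : series R.

HB.instance Definition _ := gen_eqMixin (series R).
HB.instance Definition _ := gen_choiceMixin (series R).

Definition ser_add f g : series R := fun n => f n + g n.
Definition ser_opp f : series R := fun n => - f n.
Definition ser_poly (p : {poly R}) : series R := fun n => p`_n.
Definition ser_mul f g : series R :=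
  fun n => \sum_(i < n.+1) f i * g (n - i)%N.

Lemma ser_addA : associative ser_add.
Proof. by move=> f g h; apply/funext => n; apply: addrA. Qed.
Lemma ser_addC : commutative ser_add.
Proof. by move=> f g; apply/funext => n; apply: addrC. Qed.
Lemma ser_add0 : left_id (ser_poly 0) ser_add.
Proof. by move=> f; apply/funext => n; rewrite /ser_add /ser_poly coef0 add0r. Qed.
Lemma ser_addN : left_inverse (ser_poly 0) ser_opp ser_add.
Proof. by move=> f; apply/funext => n; rewrite /ser_poly coef0; apply: addNr. Qed.

HB.instance Definition _ :=
  GRing.isZmodule.Build (series R) ser_addA ser_addC ser_add0 ser_addN.

Definition ser_trunc (f : series R) n : {poly R} := \poly_(i < n.+1) f i.

Lemma coef_ser_trunc f n i : (i <= n)%N -> (ser_trunc f n)`_i = f i.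
Proof. by move=> le_in; rewrite coef_poly ltnS le_in. Qed.

Lemma coefM_low (p q p' q' : {poly R}) n :
  (forall i, (i <= n)%N -> p`_i = p'`_i) ->
  (forall i, (i <= n)%N -> q`_i = q'`_i) -> (p * q)`_n = (p' * q')`_n.
Proof.
move=> Ep Eq; rewrite !coefM; apply: eq_bigr => i _.
by rewrite Ep ?Eq ?leq_subr // -ltnS.
Qed.

(** Up to degree N a product of series is a product of polynomials, so the ring laws are inherited
    from [{poly R}]. *)
Lemma ser_mul_trunc f g n N :
  (n <= N)%N -> ser_mul f g n = (ser_trunc f N * ser_trunc g N)`_n.
Proof.
move=> le_nN; rewrite coefM; apply: eq_bigr => i _.
rewrite !coef_ser_trunc //; first exact: leq_trans (leq_subr _ _) le_nN.
by apply: leq_trans le_nN; rewrite -ltnS.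
Qed.

Lemma ser_mulA : associative ser_mul.
Proof.
move=> f g h; apply/funext => n; rewrite !(ser_mul_trunc _ _ (leqnn n)).
transitivity ((ser_trunc f n * (ser_trunc g n * ser_trunc h n))`_n).
  by apply: coefM_low => // i le_in; rewrite coef_ser_trunc // (ser_mul_trunc _ _ le_in).
by rewrite mulrA; apply: coefM_low => // i le_in;
  rewrite coef_ser_trunc // (ser_mul_trunc _ _ le_in).
Qed.

Lemma ser_mulC : commutative ser_mul.
Proof.
by move=> f g; apply/funext => n; rewrite !(ser_mul_trunc _ _ (leqnn n)) mulrC.
Qed.

Lemma ser_mul1 : left_id (ser_poly 1) ser_mul.
Proof.
move=> f; apply/funext => n.
rewrite (ser_mul_trunc _ _ (leqnn n)) (@coefM_low _ _ 1 (ser_trunc f n)) //.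
  by rewrite mul1r coef_ser_trunc.
by move=> i le_in; rewrite coef_ser_trunc.
Qed.

Lemma ser_mulDl : left_distributive ser_mul ser_add.
Proof.
move=> f g h; apply/funext => n; rewrite /ser_add /ser_mul -big_split /=.
by apply: eq_bigr => i _; rewrite mulrDl.
Qed.

Lemma ser_1_neq0 : ser_poly 1 != 0.
Proof.
apply/eqP => /(congr1 (fun f : series R => f 0%N)) /=.
by rewrite -[RHS]/((0 : {poly R})`_0) /ser_poly coef1 coef0 => /eqP; rewrite oner_eq0.
Qed.

HB.instance Definition _ := GRing.Zmodule_isComNzRing.Build (series R)
  ser_mulA ser_mulC ser_mul1 ser_mulDl ser_1_neq0.

Lemma serD f g n : (f + g) n = f n + g n. Proof. by []. Qed.
Lemma serN f n : (- f) n = - f n. Proof. by []. Qed.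
Lemma serM f g n : (f * g) n = \sum_(i < n.+1) f i * g (n - i)%N.
Proof. by []. Qed.
Lemma ser0 n : (0 : series R) n = 0. Proof. exact: coef0. Qed.
Lemma ser1 n : (1 : series R) n = (n == 0%N)%:R.
Proof. exact: coef1. Qed.

Lemma ser_poly_is_additive : zmod_morphism ser_poly.
Proof. by move=> p q; apply/funext => n; rewrite /ser_poly coefB. Qed.
HB.instance Definition _ :=
  GRing.isZmodMorphism.Build {poly R} (series R) ser_poly ser_poly_is_additive.

Lemma ser_poly_is_multiplicative : monoid_morphism ser_poly.
Proof. by split=> // p q; apply/funext => n; rewrite /ser_poly coefM. Qed.
HB.instance Definition _ :=
  GRing.isMonoidMorphism.Build {poly R} (series R) ser_poly ser_poly_is_multiplicative.

Definition ser_x : series R := ser_poly 'X.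

Lemma ser_xnM k f n : (ser_x ^+ k * f) n = if (n < k)%N then 0 else f (n - k)%N.
Proof.
rewrite -rmorphXn -[LHS]/(ser_mul (ser_poly 'X^k) f n) (ser_mul_trunc _ _ (leqnn n)).
rewrite (@coefM_low _ _ 'X^k (ser_trunc f n)) //; last first.
  by move=> i le_in; rewrite coef_ser_trunc.
rewrite coefXnM; case: ltnP => // le_kn.
by rewrite coef_ser_trunc // leq_subr.
Qed.

(** Solves h f = 1 degree by degree without dividing by the constant term, hence an inverse only
    when f has constant term 1. *)
Fixpoint ser_inv_seq f n : seq R :=
  if n is m.+1 then
    let s := ser_inv_seq f m in
    rcons s ((m == 0%N)%:R - \sum_(i < m) s`_i * f (m - i)%N)
  else [::].
Definition ser_inv f : series R := fun n => (ser_inv_seq f n.+1)`_n.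

Lemma size_ser_inv_seq f n : size (ser_inv_seq f n) = n.
Proof. by elim: n => //= n IHn; rewrite size_rcons IHn. Qed.

Lemma nth_ser_inv_seq f n i : (i < n)%N -> (ser_inv_seq f n)`_i = ser_inv f i.
Proof.
elim: n => // n IHn; rewrite ltnS leq_eqVlt => /predU1P[-> //|lt_in].
by rewrite /= nth_rcons size_ser_inv_seq lt_in IHn.
Qed.

Lemma ser_mulVr f : f 0%N = 1 -> ser_inv f * f = 1.
Proof.
move=> f0; apply/funext => n; rewrite serM big_ord_recr /= subnn f0 mulr1.
rewrite {2}/ser_inv /= nth_rcons size_ser_inv_seq ltnn eqxx ser1.
under [X in _ + (_ - X)]eq_bigr => i _ do rewrite nth_ser_inv_seq //.
by rewrite addrC subrK.
Qed.

Lemma ser_cancel f g h : f 0%N = 1 -> f * g = f * h -> g = h.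
Proof.
move=> f0 /(congr1 ( *%R (ser_inv f))).
by rewrite !mulrA ser_mulVr // !mul1r.
Qed.

Definition ser_D f : series R := fun n => n%:R * f n.

Lemma ser_DD f g : ser_D (f + g) = ser_D f + ser_D g.
Proof. by apply/funext => n; rewrite /ser_D !serD mulrDr. Qed.
Lemma ser_DN f : ser_D (- f) = - ser_D f.
Proof. by apply/funext => n; rewrite /ser_D !serN mulrN. Qed.
Lemma ser_DM f g : ser_D (f * g) = ser_D f * g + f * ser_D g.
Proof.
apply/funext => n; rewrite serD !serM /ser_D serM mulr_sumr -big_split /=.
apply: eq_bigr => i _; rewrite -{1}(subnKC (leq_ord i)) natrD; ring.
Qed.
Lemma ser_Dx : ser_D ser_x = ser_x.
Proof.
apply/funext => n; rewrite /ser_D /ser_x /ser_poly coefX.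
by case: eqP => [->|_]; rewrite ?mulr1 ?mulr0.
Qed.
Lemma ser_DX f n : ser_D (f ^+ n.+1) = n.+1%:R * f ^+ n * ser_D f.
Proof.
elim: n => [|n IHn]; first by rewrite expr1 expr0 !mul1r.
by rewrite exprS ser_DM IHn !exprS [in RHS]mulrS; ring.
Qed.

End SeriesRing.

(** * The Jacobi triple product *)

Section QBinomial.
Variables (R : comNzRingType) (q : R).

(** The Gaussian binomial coefficient, defined by the q-Pascal rule to avoid division. For l > m the
    truncated exponent m - l is harmless, as [qbin m l] vanishes. *)
Fixpoint qbin (n k : nat) : R :=
  match n, k with
  | _, 0 => 1
  | 0, _.+1 => 0
  | m.+1, l.+1 => qbin m k + q ^+ (m - l) * qbin m l
  end.

Lemma qbin0 n : qbin n 0 = 1. Proof. by case: n. Qed.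

Lemma qbin_small n k : (n < k)%N -> qbin n k = 0.
Proof.
elim: n k => [|n IHn] [|k] //= lt_nk.
by rewrite !IHn ?mulr0 ?addr0 //; lia.
Qed.

(** The q-binomial theorem in homogeneous form; the extra variable [y] will receive Q^N, which
    spares negative powers. *)
Lemma qbinomial (y z : R) n :
  \prod_(j < n) (y + z * q ^+ j) =
  \sum_(k < n.+1) q ^+ 'C(k, 2) * qbin n k * z ^+ k * y ^+ (n - k).
Proof.
elim: n => [|n IHn].
  by rewrite big_ord0 big_ord_recl big_ord0 /= addr0 !mulr1.
rewrite big_ord_recr /= {}IHn mulrDr [in RHS]big_ord_recl /=.
rewrite [in X in _ = _ + X](eq_bigr (fun k : 'I_n.+1 =>
   q ^+ 'C(k.+1, 2) * qbin n k.+1 * z ^+ k.+1 * y ^+ (n - k)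
   + (q ^+ 'C(k, 2) * qbin n k * z ^+ k * y ^+ (n - k)) * (z * q ^+ n))); last first.
  move=> k _; rewrite /bump /= add1n subSS binS bin1 mulrDr !mulrDl; congr (_ + _).
  have -> : q ^+ n = q ^+ (n - k) * q ^+ k by rewrite -exprD subnK // -ltnS.
  rewrite exprD exprS; ring.
rewrite big_split /= addrA -mulr_suml; congr (_ + _).
rewrite [in RHS]big_ord_recr /= qbin_small // mulr0 !mul0r addr0 [in LHS]big_ord_recl mulrDl.
rewrite /= subn0 qbin0 mulr_suml; congr (_ + _); first by rewrite subn0 exprSr mulrA.
apply: eq_bigr => k _; rewrite /bump /= add1n -mulrA -exprSr.
by congr (_ * _ ^+ _); have := ltn_ord k; lia.
Qed.

Definition qfact n := \prod_(j < n) (1 - q ^+ j.+1).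

Lemma qbin_qfact n k : (k <= n)%N -> qfact k * qfact (n - k) * qbin n k = qfact n.
Proof.
rewrite /qfact; elim: n k => [|n IHn] [|k] // le_kn.
- by rewrite big_ord0 !mulr1.
- by rewrite subn0 qbin0 big_ord0 mul1r mulr1.
rewrite subSS /=; have [->|lt_kn] := eqVneq k n.
  rewrite subnn qbin_small // expr0 !big_ord_recr /= big_ord0.
  have := IHn n (leqnn n); rewrite subnn big_ord0 => E.
  by rewrite -[in RHS]E; ring.
have le_kn' : (k <= n)%N by lia.
have lt_kn' : (k.+1 <= n)%N by lia.
have := IHn _ le_kn'; have := IHn _ lt_kn'.
have -> : (n - k = (n - k.+1).+1)%N by lia.
rewrite !big_ord_recr /= => E1 E2.
rewrite mulrDr.
(* The factor 1 - q^(n+1) is split to match the two terms of the Pascal rule, each governed by one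
   induction hypothesis. *)
transitivity (((1 - q ^+ (n - k.+1).+1) + q ^+ (n - k.+1).+1 * (1 - q ^+ k.+1)) *
  \prod_(j < n) (1 - q ^+ j.+1)).
  rewrite mulrDl -{1}E1 -E2; ring.
have -> : q ^+ n.+1 = q ^+ (n - k.+1).+1 * q ^+ k.+1 by rewrite -exprD; congr (_ ^+ _); lia.
ring.
Qed.

End QBinomial.

(* The triangular number n(n+1)/2; the branches agree since Negz m is -(m+1). *)
Definition tri (n : int) : nat :=
  match n with Posz m => 'C(m.+1, 2) | Negz m => 'C(m.+1, 2) end.

Lemma bin2_mul n : ('C(n.+1, 2) * 2 = n.+1 * n)%N.
Proof. by have := mul_bin_diag n.+1 1; rewrite bin1 mulnC => ->; rewrite mulnC. Qed.

Lemma triE (n : int) : (tri n)%:Z * 2 = n * (n + 1).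
Proof.
case: n => m; rewrite /tri; have := bin2_mul m; first by nia.
by rewrite NegzE; nia.
Qed.

(** The exponents of Ramanujan's general theta function f(q^al, q^be). *)
Definition texp (al be : nat) (n : int) : nat := (al * tri n + be * tri (n - 1))%N.

Lemma texpE al be n :
  (texp al be n)%:Z * 2 = (al%:Z + be%:Z) * (n * n) + (al%:Z - be%:Z) * n.
Proof.
rewrite /texp PoszD !PoszM mulrDl -!mulrA !triE; ring.
Qed.

Section FiniteJacobi.
Variables (F : fieldType) (s : F) (al be : nat).
Hypothesis s_neq0 : s != 0.
Let Q : {poly F} := 'X^(al + be).

(** The q-binomial theorem is applied to the 2N factors Q^N + s X^al Q^j. The upper half gives the
    first product; in the lower half s X^al Q^j is factored out and the order reversed, which gives
    the second. Multiplying both sides by s^N and a power of X keeps all exponents of X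
    nonnegative. *)
Lemma finite_jacobi N :
  (\prod_(j < N) (1 + s *: 'X^al * Q ^+ j)) *
  (\prod_(j < N) (1 + s^-1 *: 'X^be * Q ^+ j)) =
  \sum_(k < (2 * N).+1) qbin Q (2 * N) k * (s ^ (k%:Z - N%:Z) *: 'X^(texp al be (k%:Z - N%:Z))).
Proof.
have mon : Q ^+ ('C(N, 2) + N * N) * 'X^(al * N) != 0.
  by rewrite mulf_neq0 // -?exprM -?exprD ?expf_neq0 ?polyX_eq0.
have sN : (s ^+ N)%:P != 0 by rewrite polyC_eq0 expf_neq0.
apply: (mulfI mon); apply: (mulfI sN).
transitivity (\prod_(j < 2 * N) (Q ^+ N + s *: 'X^al * Q ^+ j)).
  rewrite mul2n -addnn big_split_ord /=.
  have -> : \prod_(i < N) (Q ^+ N + s *: 'X^al * Q ^+ (N + i)) =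
     Q ^+ (N * N) * \prod_(j < N) (1 + s *: 'X^al * Q ^+ j).
    transitivity (\prod_(i < N) (Q ^+ N * (1 + s *: 'X^al * Q ^+ i))).
      by apply: eq_bigr => i _; rewrite exprD; ring.
    by rewrite big_split /= prodr_const card_ord -exprM.
  have -> : \prod_(i < N) (Q ^+ N + s *: 'X^al * Q ^+ i) =
     (s ^+ N)%:P * Q ^+ 'C(N, 2) * 'X^(al * N) * \prod_(j < N) (1 + s^-1 *: 'X^be * Q ^+ j).
    rewrite [in RHS](reindex_inj rev_ord_inj) /=.
    have -> : Q ^+ 'C(N, 2) = \prod_(i < N) Q ^+ i.
      by rewrite prodrXr -bin2_sum big_mkord.
    have -> : (s ^+ N)%:P * \prod_(i < N) Q ^+ i * 'X^(al * N) =
      \prod_(i < N) (s *: 'X^al * Q ^+ i).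
      rewrite big_split /= prodr_const card_ord exprZn -exprM -mul_polyC; ring.
    rewrite -big_split /=; apply: eq_bigr => i _.
    rewrite mulrDr mulr1 addrC; congr (_ + _).
    have -> : Q ^+ N = Q ^+ i * Q ^+ (N - i.+1) * 'X^al * 'X^be.
      have Ei : (N = i + (N - i.+1) + 1)%N by have := ltn_ord i; lia.
      by rewrite {1}Ei !exprD expr1 /Q exprD; ring.
    rewrite -!mul_polyC.
    have Es : s%:P * (s^-1)%:P = 1 by rewrite -polyCM divff.
    transitivity ((s%:P * (s^-1)%:P) * (Q ^+ i * Q ^+ (N - i.+1) * 'X^al * 'X^be));
      first by rewrite Es mul1r.
    ring.
  rewrite !exprD; ring.
rewrite qbinomial !mulr_sumr; apply: eq_bigr => k _.
rewrite exprZn -[s ^+ k *: _]mul_polyC -[s ^ _ *: _]mul_polyC.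
have -> : s ^+ k = s ^+ N * s ^ (k%:Z - N%:Z).
  by rewrite -[s ^+ N]/(s ^ N%:Z) -expfzDr // addrC subrK.
rewrite polyCM.
have E : Q ^+ 'C(k, 2) * 'X^al ^+ k * Q ^+ N ^+ (2 * N - k) =
  Q ^+ ('C(N, 2) + N * N) * 'X^(al * N) * 'X^(texp al be (k%:Z - N%:Z)).
  rewrite /Q -!exprM -!exprD; congr ('X^_).
  have binE m : ('C(m, 2)%:Z * 2 = m%:Z * (m%:Z - 1)).
    by case: m => // m; have := bin2_mul m; lia.
  have le_k : (k <= 2 * N)%N by rewrite -ltnS.
  have Ek := binE k; have EN := binE N.
  have ET := texpE al be (k%:Z - N%:Z).
  move: (texp _ _ _) ET => T ET.
  have Es : (2 * N - k)%N%:Z = 2 * N%:Z - k%:Z by lia.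
  (* Doubling turns the triangular numbers and [texp] into polynomials. *)
  suff : (((al + be) * 'C(k, 2) + al * k + (al + be) * N * (2 * N - k))%N%:Z * 2
     = ((al + be) * ('C(N, 2) + N * N) + al * N + T)%N%:Z * 2) by lia.
  rewrite !(PoszD, PoszM) Es !mulrDl ET.
  transitivity ((al%:Z + be%:Z) * ('C(k, 2)%:Z * 2) +
    al%:Z * k%:Z * 2 + (al%:Z + be%:Z) * N%:Z * (2 * N%:Z - k%:Z) * 2); first by ring.
  rewrite Ek; apply/esym.
  transitivity ((al%:Z + be%:Z) * ('C(N, 2)%:Z * 2 + N%:Z * N%:Z * 2) +
    al%:Z * N%:Z * 2 + ((al%:Z + be%:Z) * ((k%:Z - N%:Z) * (k%:Z - N%:Z)) +
      (al%:Z - be%:Z) * (k%:Z - N%:Z))); first by ring.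
  rewrite EN; ring.
transitivity ((s ^+ N)%:P * (s ^ (k%:Z - N%:Z))%:P * qbin Q (2 * N) k * (Q ^+ 'C(k, 2) *
  'X^al ^+ k * Q ^+ N ^+ (2 * N - k))); first by ring.
rewrite E; ring.
Qed.

End FiniteJacobi.

Section Agreement.
Variable R : comNzRingType.
Implicit Types f g h : series R.

(** Congruence modulo q^(m+1), the means to pass from finite products to infinite ones. *)
Definition ser_eqm m f g := forall i, (i <= m)%N -> f i = g i.

Lemma ser_eqm_sym m f g : ser_eqm m f g -> ser_eqm m g f.
Proof. by move=> E i le_im; rewrite E. Qed.
Lemma ser_eqm_trans m f g h : ser_eqm m f g -> ser_eqm m g h -> ser_eqm m f h.
Proof. by move=> E1 E2 i le_im; rewrite E1 ?E2. Qed.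
Lemma ser_eqmM m f f' g g' :
  ser_eqm m f f' -> ser_eqm m g g' -> ser_eqm m (f * g) (f' * g').
Proof.
move=> Ef Eg i le_im; rewrite !serM; apply: eq_bigr => j _.
by rewrite Ef ?Eg //; have := ltn_ord j; lia.
Qed.
Lemma ser_eqm_cancel m f g h :
  f 0%N = 1 -> ser_eqm m (f * g) (f * h) -> ser_eqm m g h.
Proof.
move=> f0 E; rewrite -[g]mul1r -[h]mul1r -(ser_mulVr f0) -!mulrA.
exact: ser_eqmM.
Qed.
Lemma ser_eqmP f g : (forall m, ser_eqm m f g) -> f = g.
Proof. by move=> E; apply/funext => m; apply: (E m). Qed.

(** The analogue of [qpoch] over any coefficient ring, as needed after reduction modulo 3. *)
Definition pprod (a b : {poly R}) : series R :=
  fun n => (\prod_(j < n.+1) (1 - a * b ^+ j))`_n.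

(** Since b is a multiple of X, the j-th factor is 1 modulo X^j and does not touch lower
    coefficients. *)
Lemma pprod_eqm (a b : {poly R}) m N : b`_0 = 0 -> (m < N)%N ->
  ser_eqm m (pprod a b) (ser_poly (\prod_(j < N) (1 - a * b ^+ j))).
Proof.
move=> b0; have [c ->] : exists c, b = c * 'X.
  exists (drop_poly 1 b); rewrite -[LHS](poly_take_drop 1) expr1.
  suff -> : take_poly 1 b = 0 by rewrite add0r.
  by apply/polyP => -[|i]; rewrite coef_take_poly coef0.
case: N => // N; rewrite ltnS => le_mN i le_im; rewrite /ser_poly.
have: (i <= N)%N by apply: leq_trans le_mN.
elim: N {m le_mN le_im} => [|N IHN]; first by rewrite leqn0 => /eqP ->.
rewrite leq_eqVlt => /predU1P[-> //|lt_nN].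
rewrite big_ord_recr /= mulrBr mulr1 coefB -IHN //.
by rewrite exprMn !mulrA coefMXn lt_nN subr0.
Qed.

End Agreement.

(* \sum_(i \in A) is 0 when infinitely many terms are nonzero, whence the
   assumption [locally_finite] below. *)
Definition thser (R : nmodType) (I : choiceType) (e : I -> nat) (w : I -> R) : series R :=
  fun m => \sum_(i \in [set i | e i = m]%classic) w i.

(** This yields local finiteness. The successor is there because n(n-1)/2 vanishes at n = 1, and
    n(n+1)/2 at n = -1. *)
Lemma texp_bound al be n : (0 < al + be)%N -> (`|n| <= (texp al be n).+1)%N.
Proof. by have := texpE al be n; nia. Qed.

Section Jacobi.
Variables (F : fieldType) (s : F) (al be : nat).
Hypotheses (s_neq0 : s != 0) (albe_gt0 : (0 < al + be)%N).
Let Q : {poly F} := 'X^(al + be).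

Let Q0 : Q`_0 = 0. Proof. by rewrite coefXn; case: eqP => //; lia. Qed.

Let pprod_qfact m n : (m < n)%N -> ser_eqm m (pprod Q Q) (ser_poly (qfact Q n)).
Proof.
move=> lt_mn; suff <- : \prod_(j < n) (1 - Q * Q ^+ j) = qfact Q n by apply: pprod_eqm.
by apply: eq_bigr => j _; rewrite exprS.
Qed.

(** In [qbin_qfact] all three [qfact] agree with (Q;Q)_oo up to degree m, and one of them
    cancels. *)
Lemma qbin_qfact_eqm m n k : (m < k <= n)%N -> (m < n - k)%N ->
  ser_eqm m (ser_poly (qbin Q n k * qfact Q n)) 1.
Proof.
move=> /andP[lt_mk le_kn] lt_mnk.
have lt_mn : (m < n)%N by apply: leq_trans le_kn.
have f0 : pprod Q Q 0%N = 1 by rewrite /pprod big_ord1 expr0 mulr1 coefB Q0 coef1 subr0.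
have En := pprod_qfact lt_mn.
apply: (ser_eqm_cancel f0); rewrite mulr1; apply: ser_eqm_trans (ser_eqm_sym En).
rewrite -{2}(qbin_qfact Q le_kn) [qbin _ _ _ * _]mulrC !rmorphM /= mulrA.
apply: ser_eqmM => //; apply: (@ser_eqm_trans _ m _ (pprod Q Q * pprod Q Q)).
  by apply: ser_eqmM => //; apply: ser_eqm_sym.
by apply: ser_eqmM; apply: pprod_qfact.
Qed.

(** The limit of [finite_jacobi] as N grows, taken one coefficient at a time. *)
Lemma jacobi_triple :
  thser (texp al be) (fun n => s ^ n) =
  pprod (- s *: 'X^al) Q * pprod (- s^-1 *: 'X^be) Q * pprod Q Q.
Proof.
(* An exponent at most m forces an index of absolute value at most m + 1, so this N keeps both k and
   2N - k above m, as [qbin_qfact_eqm] requires. *)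
apply/funext => m; set N := (2 * m).+3.
rewrite (ser_eqmM (ser_eqmM (pprod_eqm _ Q0 (_ : m < N)%N) (pprod_eqm _ Q0 (_ : m < N)%N))
          (pprod_eqm _ Q0 (_ : m < 2 * N)%N)) //; try lia.
rewrite -!rmorphM /=.
have -> : \prod_(j < N) (1 - - s *: 'X^al * Q ^+ j) = \prod_(j < N) (1 + s *: 'X^al * Q ^+ j).
  by apply: eq_bigr => j _; rewrite scaleNr mulNr opprK.
have -> : \prod_(j < N) (1 - - s^-1 *: 'X^be * Q ^+ j) =
  \prod_(j < N) (1 + s^-1 *: 'X^be * Q ^+ j).
  by apply: eq_bigr => j _; rewrite scaleNr mulNr opprK.
have -> : \prod_(j < 2 * N) (1 - Q * Q ^+ j) = qfact Q (2 * N).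
  by apply: eq_bigr => j _; rewrite exprS.
rewrite finite_jacobi // mulr_suml /ser_poly coef_sum.
pose z (k : nat) : int := k%:Z - N%:Z; have zE k : z k = k%:Z - N%:Z by [].
clearbody z.
transitivity (\sum_(k < (2 * N).+1) (if texp al be (z k) == m then s ^ z k else 0)); last first.
  apply: eq_bigr => k _.
  rewrite -zE mulrAC -scalerAr coefZ coefMXn.
  (* The product of [qbin] and [qfact] is 1 up to the degree needed, so only the terms of exponent
     exactly m survive. *)
  case: (ltngtP (texp al be (z k)) m) => [lt|lt|E].
  - have b := texp_bound (z k) albe_gt0; have zk := zE k.
    rewrite [X in _ * X](_ : _ = 0) ?mulr0 //.
    have := @qbin_qfact_eqm m (2 * N) k _ _ (m - texp al be (z k))%N.
    rewrite /ser_poly => ->; try lia.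
    by rewrite ser1; case: eqP => // ?; exfalso; lia.
  - by rewrite mulr0.
  - rewrite E subnn.
    have b := texp_bound (z k) albe_gt0; have zk := zE k.
    have := @qbin_qfact_eqm m (2 * N) k _ _ 0%N.
    rewrite /ser_poly => ->; try lia.
    by rewrite ser1 mulr1.
rewrite -big_mkcond -(big_mkord (fun k => texp al be (z k) == m) (fun k => s ^ z k)).
rewrite -(big_map z (fun n => texp al be n == m) (fun n => s ^ n)) bigfs.
- by apply: eq_fsbigl; apply/seteqP; split=> n /= /eqP.
- rewrite map_inj_uniq ?iota_uniq // => i j; rewrite !zE; lia.
- move=> n /eqP E /mapP[].
  exists (absz ((n : int) + N%:Z)); rewrite ?mem_index_iota ?zE;
    have := texp_bound n albe_gt0; lia.
Qed.

End Jacobi.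

(** * Euler products *)

Section Products.
Variable F : fieldType.
Implicit Types (a b : {poly F}).

(** The factors are sorted by the residue of j modulo m. *)
Lemma pprod_split a b m : b`_0 = 0 -> (0 < m)%N ->
  pprod a b = \prod_(i < m) pprod (a * b ^+ i) (b ^+ m).
Proof.
move=> b0 m_gt0; apply: ser_eqmP => n.
have bm0 : (b ^+ m)`_0 = 0 by case: m m_gt0 => // m _; rewrite exprS coef0M b0 mul0r.
apply: ser_eqm_trans (pprod_eqm a b0 (_ : n < m * n.+1)%N) _; first by nia.
have -> N : \prod_(j < m * N) (1 - a * b ^+ j) =
  \prod_(i < m) \prod_(j < N) (1 - a * b ^+ i * (b ^+ m) ^+ j).
  elim: N => [|N IHN].
    by rewrite muln0 big_ord0 big1 // => i _; rewrite big_ord0.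
  rewrite mulnS addnC big_split_ord /= IHN.
  under [RHS]eq_bigr do rewrite big_ord_recr /=.
  rewrite big_split /=; congr (_ * _); apply: eq_bigr => i _.
  by rewrite exprD -exprM; ring.
rewrite rmorph_prod /=; apply: ser_eqm_sym.
apply: (big_ind2 (fun f g => ser_eqm n f g)) => //.
- by move=> *; apply: ser_eqmM.
- by move=> i _; apply: pprod_eqm.
Qed.

Lemma pprod_sqr a b : b`_0 = 0 -> pprod (- a) b * pprod a b = pprod (a ^+ 2) (b ^+ 2).
Proof.
move=> b0; apply: ser_eqmP => n.
have b20 : (b ^+ 2)`_0 = 0 by rewrite expr2 coef0M b0 mul0r.
apply: ser_eqm_trans (ser_eqmM (pprod_eqm _ b0 (ltnSn n)) (pprod_eqm _ b0 (ltnSn n))) _.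
rewrite -rmorphM -big_split /=; apply: ser_eqm_trans (ser_eqm_sym (pprod_eqm _ b20 (ltnSn n))).
suff -> : \prod_(i < n.+1) ((1 - - a * b ^+ i) * (1 - a * b ^+ i)) =
  \prod_(j < n.+1) (1 - a ^+ 2 * b ^+ 2 ^+ j) by [].
by apply: eq_bigr => i _; rewrite -exprM mulnC exprM; ring.
Qed.

Lemma pprod_recl a b : b`_0 = 0 -> pprod a b = ser_poly (1 - a) * pprod (a * b) b.
Proof.
move=> b0; apply: ser_eqmP => n.
apply: ser_eqm_trans (pprod_eqm a b0 (_ : n < n.+2)%N) _; first by lia.
rewrite big_ord_recl rmorphM /= expr0 mulr1; apply: ser_eqmM => //.
apply: ser_eqm_trans (ser_eqm_sym (pprod_eqm _ b0 (ltnSn n))).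
suff -> : \prod_(i < n.+1) (1 - a * b ^+ bump 0 i) =
  \prod_(j < n.+1) (1 - a * b * b ^+ j) by [].
by apply: eq_bigr => i _; rewrite /bump add1n exprS mulrA.
Qed.

Definition euler k : series F := pprod 'X^k 'X^k.
(* Ramanujan's general theta function f(s q^al, s^-1 q^be). *)
Definition theta (s : F) al be : series F := thser (texp al be) (fun n => s ^ n).

Let coef0_Xk k : (0 < k)%N -> ('X^k : {poly F})`_0 = 0.
Proof. by rewrite coefXn; case: k. Qed.

Lemma euler0 k : (0 < k)%N -> euler k 0%N = 1.
Proof.
by move=> k_gt0; rewrite /euler /pprod big_ord1 expr0 mulr1 coefB coef1 coef0_Xk ?subr0.
Qed.

Lemma pprodN_euler k : (0 < k)%N -> pprod (- 'X^k) 'X^k * euler k = euler (2 * k).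
Proof. by move=> k0; rewrite pprod_sqr ?coef0_Xk // -!exprM mulnC. Qed.

Lemma euler_odd k : (0 < k)%N -> euler k = pprod 'X^k 'X^(2 * k) * euler (2 * k).
Proof.
move=> k0; rewrite /euler (@pprod_split 'X^k 'X^k 2) ?coef0_Xk //.
by rewrite !big_ord_recl big_ord0 /= mulr1 expr0 mulr1 expr1 -exprD -exprM addnn mul2n muln2.
Qed.

(** The triple product is (q^k;q^2k)^2 (q^2k;q^2k), and (q^k;q^2k) is f_k / f_2k. *)
Lemma theta_gauss k : (0 < k)%N -> theta (-1) k k * euler (2 * k) = euler k ^+ 2.
Proof.
move=> k0; rewrite /theta jacobi_triple ?oppr_eq0 ?oner_eq0 //; last by lia.
rewrite invrN invr1 opprK scale1r addnn -mul2n (euler_odd k0) /euler; ring.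
Qed.

(** This theta series is 2 psi(q^k), since n and -n - 1 share a triangular number; on the product
    side the 2 is the first factor 1 + q^0. *)
Lemma theta_triangular k : (0 < k)%N -> theta 1 k 0 * euler k = euler (2 * k) ^+ 2 *+ 2.
Proof.
move=> k0; rewrite /theta jacobi_triple ?oner_eq0 ?addn0 //.
rewrite invr1 !scaleN1r -[pprod 'X^k 'X^k]/(euler k).
rewrite [pprod (- 'X^0) _]pprod_recl ?coef0_Xk // expr0 opprK mulN1r -(pprodN_euler k0).
by rewrite rmorphD rmorph1; ring.
Qed.

(** The triple products supply the classes 1, 4, 3, 2 modulo 5 of (-q;q)_oo; the class 0 is
    (-q^5;q^5)_oo. *)
Lemma theta_quintic1 :
  theta 1 1 4 * theta 1 3 2 * euler 1 * euler 10 = euler 2 * euler 5 ^+ 3.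
Proof.
rewrite /theta !jacobi_triple ?oner_eq0 // invr1 !scaleN1r -[pprod 'X^5 'X^5]/(euler 5).
rewrite -(pprodN_euler (isT : 0 < 1)%N) -(pprodN_euler (isT : 0 < 5)%N).
rewrite (@pprod_split (- 'X^1) 'X^1 5) ?coef0_Xk // !big_ord_recl big_ord0 /=.
rewrite /bump /= -!exprM !mulNr -!exprD /=; ring.
Qed.

(** The triple products supply the classes 9, 1, 7, 3 modulo 10 of (q;q^2)_oo; the class 5 is
    (q^5;q^10)_oo. *)
Lemma theta_quintic2 :
  theta (-1) 9 1 * theta (-1) 7 3 * euler 2 * euler 5 = euler 1 * euler 10 ^+ 3.
Proof.
rewrite /theta !jacobi_triple ?oppr_eq0 ?oner_eq0 // invrN invr1 opprK !scale1r.
rewrite -[pprod 'X^10 'X^10]/(euler 10) (euler_odd (isT : 0 < 1)%N) (euler_odd (isT : 0 < 5)%N).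
rewrite (@pprod_split 'X^1 'X^(2 * 1) 5) ?coef0_Xk // !big_ord_recl big_ord0 /=.
rewrite /bump /= -!exprM -!exprD /=; ring.
Qed.

End Products.

(** * Theta series over lattices *)

Section SummableFamilies.
Variable R : comNzRingType.

Definition locally_finite (I : eqType) (e : I -> nat) :=
  forall m, exists r : seq I, forall i, (e i <= m)%N -> i \in r.

Variables I J : choiceType.
Implicit Types (e : I -> nat) (w : I -> R).

Lemma eq_thser e e' w w' : e =1 e' -> w =1 w' -> thser e w = thser e' w'.
Proof. by move=> /funext -> /funext ->. Qed.

Lemma thserE e w m (r : seq I) : uniq r -> (forall i, e i = m -> i \in r) ->
  thser e w m = \sum_(i <- r | e i == m) w i.
Proof.
move=> ur er; rewrite bigfs //.
  by apply: eq_fsbigl; apply/seteqP; split=> n /= /eqP.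
by move=> i /eqP /er ->.
Qed.

Lemma locally_finiteE e : locally_finite e ->
  forall m, exists2 r : seq I, uniq r & forall i, (e i <= m)%N -> i \in r.
Proof.
move=> pe m; have [r er] := pe m; exists (undup r); first exact: undup_uniq.
by move=> i /er; rewrite mem_undup.
Qed.

Lemma thserN e w : locally_finite e -> thser e (fun i => - w i) = - thser e w.
Proof.
move=> pe; apply/funext => m; have [r ur er] := locally_finiteE pe m.
have {}er i : e i = m -> i \in r by move=> E; apply: er; rewrite E.
by rewrite serN !(thserE _ ur er) sumrN.
Qed.

Lemma ser_xn_thser e w k : ser_x R ^+ k * thser e w = thser (fun i => (k + e i)%N) w.
Proof.
apply/funext => m; rewrite ser_xnM; case: ltnP => [lt_mk|le_km].
  by rewrite /thser fsbig1 // => i /= E; exfalso; lia.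
by apply: eq_fsbigl; apply/seteqP; split=> i /=; lia.
Qed.

Lemma thser_inj e w (h : J -> I) (g : I -> J) (P : pred I) :
  (forall j, P (h j)) -> cancel h g -> (forall i, P i -> h (g i) = i) ->
  thser e (fun i => if P i then w i else 0) = thser (e \o h) (w \o h).
Proof.
move=> Ph hg gh; apply/funext => m; rewrite /thser.
have PE i : P i = (i \in [set` P]%classic) by rewrite mem_setE.
under eq_fsbigr => i _ do rewrite PE.
rewrite -fsbig_mkcondr; apply: reindex_fsbig; split.
- by move=> j /= E; split=> //=; apply: Ph.
- by move=> j j' _ _ /(congr1 g); rewrite !hg.
- by move=> i /= [E Pi]; exists (g i) => /=; rewrite gh.
Qed.

Lemma thser_partition n (ka : I -> 'I_n) (h : 'I_n -> J -> I) (g : 'I_n -> I -> J) e w :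
  locally_finite e -> (forall c j, ka (h c j) = c) -> (forall c, cancel (h c) (g c)) ->
  (forall i, h (ka i) (g (ka i) i) = i) ->
  thser e w = \sum_(c < n) thser (e \o h c) (w \o h c).
Proof.
move=> pe kah hg gh.
transitivity (\sum_(c < n) thser e (fun i => if ka i == c then w i else 0)).
  apply/funext => m; have [r ur er] := locally_finiteE pe m.
  have ev (f : 'I_n -> series R) : (\sum_(c < n) f c) m = \sum_(c < n) (f c m : R).
    apply: (big_ind2 (fun (x : series R) y => x m = y)) => [|x y x' y' <- <-|] //.
    exact: ser0.
  have {}er i : e i = m -> i \in r by move=> E; apply: er; rewrite E.
  rewrite ev (thserE _ ur er).
  under [RHS]eq_bigr do rewrite (thserE _ ur er).
  rewrite exchange_big /=; apply: eq_bigr => i _.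
  by rewrite -big_mkcond (big_pred1 (ka i)) // => c; rewrite eq_sym.
apply: eq_bigr => c _; apply: (@thser_inj e w (h c) (g c) (fun i => ka i == c)) =>
  [j|//|i /eqP <-//].
by rewrite kah.
Qed.

End SummableFamilies.

Lemma locally_finite_pair (I J : eqType) (e : I -> nat) (f : J -> nat) :
  locally_finite e -> locally_finite f -> locally_finite (fun z : I * J => (e z.1 + f z.2)%N).
Proof.
move=> pe pf m; have [r er] := pe m; have [s fs] := pf m.
exists (allpairs pair r s) => -[i j] /= le_m.
by apply: allpairs_f; [apply: er | apply: fs]; lia.
Qed.

Lemma thserM (R : comNzRingType) (I J : choiceType) (e : I -> nat) (f : J -> nat)
    (w : I -> R) (v : J -> R) : locally_finite e -> locally_finite f ->
  thser e w * thser f v = thser (fun z : I * J => (e z.1 + f z.2)%N) (fun z => w z.1 * v z.2).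
Proof.
move=> pe pf; apply/funext => m.
have [r ur er] := locally_finiteE pe m; have [s us fs] := locally_finiteE pf m.
rewrite (@thserE _ _ _ _ _ (allpairs pair r s)); first last.
- by move=> [i j] /= E; apply: allpairs_f; [apply: er | apply: fs]; lia.
- by apply: allpairs_uniq => // -[? ?] [? ?].
rewrite big_mkcond big_allpairs_dep /= serM.
transitivity (\sum_(k < m.+1) \sum_(i <- r) \sum_(j <- s)
    if (e i == k) && (f j == m - k)%N then w i * v j else 0).
  apply: eq_bigr => k _; have := ltn_ord k; rewrite ltnS => le_km.
  rewrite (thserE _ ur) => [|i Ei]; last by apply: er; lia.
  rewrite (thserE _ us) => [|i Ei]; last by apply: fs; lia.
  rewrite big_distrl big_mkcond /=; apply: eq_bigr => i _.
  case: eqP => _ /=; last by rewrite big1.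
  by rewrite big_distrr big_mkcond.
rewrite exchange_big; apply: eq_bigr => i _ /=.
rewrite exchange_big; apply: eq_bigr => j _ /=.
case: eqP => [E|E].
  have lt_e : (e i < m.+1)%N by lia.
  rewrite (bigD1 (Ordinal lt_e)) //= eqxx big1 ?addr0 => [|k].
    by case: eqP => //; lia.
  by rewrite -val_eqE eq_sym /= => /negbTE ->.
by rewrite big1 // => k _; case: andP => // -[/eqP ? /eqP ?]; have := ltn_ord k; lia.
Qed.

Lemma locally_finite_texp al be : (0 < al + be)%N -> locally_finite (texp al be).
Proof.
move=> gt0 m; exists [seq k%:Z - m.+1%:Z | k <- iota 0 (2 * m.+1).+1] => n le_m.
have b := texp_bound n gt0; apply/mapP; exists (absz (n + m.+1%:Z)); last by lia.
by rewrite mem_iota; lia.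
Qed.

(** * The two level 10 relations *)

Section Quintic.
Variable F : fieldType.

(** Modulo 2 + i one has i = -2, so x - 2y modulo 5 labels the coset of x + iy. In the odd
    coordinates 2x + 1 and 2y + 1 the ideal itself is the class x - 2y = 3, whence the shift d. *)
Definition rot5 (d : int) (z : int * int) : 'I_5 := inord (absz ((z.1 - 2 * z.2 - d) %% 5)%Z).

Lemma rot5E d z : (rot5 d z : nat)%:Z = ((z.1 - 2 * z.2 - d) %% 5)%Z.
Proof. by rewrite /rot5 inordK; lia. Qed.

(* In the coordinates 2x + 1 and 2y + 1: the ideal (2 + i), then the images of
   one of its other cosets under multiplication by the powers of i. *)
Definition odd_lines (c : nat) (z : int * int) : int * int :=
  let: (j, k) := z in
  match c with
  | 0 => (2 * j - k, j + 2 * k + 1)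
  | 1 => (j - 2 * k - 1, - 2 * j - k)
  | 2 => (- 2 * j - k, 2 * k - j)
  | 3 => (2 * j + k - 1, j - 2 * k - 1)
  | _ => (2 * k - j, 2 * j + k - 1)
  end.

(** Inverts [odd_lines c] on the coset c, where the divisions are exact. *)
Definition odd_lines_inv (c : nat) (z : int * int) : int * int :=
  let: (x, y) := z in
  match c with
  | 0 => (((2 * x + y - 1) %/ 5)%Z, ((2 * y - x - 2) %/ 5)%Z)
  | 1 => (((x - 2 * y + 1) %/ 5)%Z, ((- 2 * x - y - 2) %/ 5)%Z)
  | 2 => (((- 2 * x - y) %/ 5)%Z, ((2 * y - x) %/ 5)%Z)
  | 3 => (((2 * x + y + 3) %/ 5)%Z, ((x - 2 * y - 1) %/ 5)%Z)
  | _ => (((2 * y - x + 2) %/ 5)%Z, ((y + 2 * x + 1) %/ 5)%Z)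
  end.

(** As the theta series is 2 psi, this reads psi(q)^2 = q psi(q^5)^2 + f(q,q^4) f(q^3,q^2). The norm
    (2x+1)^2 + (2y+1)^2 is 8 times the exponent plus 2. Multiplication by 2 + i scales it by 5,
    which gives the first term; multiplication by i makes the other four cosets contribute
    equally. *)
Lemma theta_triangular_sqr :
  theta (1 : F) 1 0 ^+ 2 =
  ser_x F * theta 1 5 0 ^+ 2 + (theta 1 1 4 * theta 1 3 2) *+ 4.
Proof.
have p0 : locally_finite (texp 1 0) by apply: locally_finite_texp.
have p5 : locally_finite (texp 5 0) by apply: locally_finite_texp.
have p1 : locally_finite (texp 1 4) by apply: locally_finite_texp.
have p2 : locally_finite (texp 3 2) by apply: locally_finite_texp.
rewrite !expr2 /theta !thserM // -[ser_x F]expr1 ser_xn_thser.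
rewrite [LHS](@thser_partition F _ _ 5 (rot5 3) (fun c => odd_lines c)
  (fun c => odd_lines_inv c)); first last.
- move=> [x y]; have /= := rot5E 3 (x, y); move: (rot5 3 _) => [c /= lt_c5] E.
  move: c lt_c5 E => [|[|[|[|[|//]]]]] _ E; rewrite /odd_lines_inv /odd_lines; congr pair; lia.
- by move=> [[|[|[|[|[|//]]]]] lt_c5] [j k] /=; congr pair; lia.
- move=> c [j k]; apply: val_inj; have := rot5E 3 (odd_lines c (j, k)).
  move: (rot5 3 _) => [d /= lt_d5].
  by case: c => [[|[|[|[|[|//]]]]] lt_c5] /=; lia.
- exact: locally_finite_pair.
have four (f : series F) : f *+ 4 = f + (f + (f + f)) by ring.
rewrite !big_ord_recl big_ord0 addr0 four; congr (_ + _).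
  apply: eq_thser => -[j k] /=; last by rewrite !exp1rz.
  have := texpE 1 0 (2 * j - k); have := texpE 1 0 (j + 2 * k + 1).
  have := texpE 5 0 j; have := texpE 5 0 k; nia.
have E z : (texp 1 0 z)%:Z * 2 = z * z + z by rewrite texpE; ring.
have E1 := texpE 1 4; have E2 := texpE 3 2.
by congr (_ + (_ + (_ + _))); apply: eq_thser => -[j k] /=;
  rewrite ?exp1rz //; move: (E1 j) (E2 k); set u := texp _ _ _; set v := texp _ _ _;
  set a := texp _ _ _; set b := texp _ _ _; move: (E _ : a%:Z * 2 = _) (E _ : b%:Z * 2 = _);
    nia.
Qed.

(* The same cosets in the coordinates x and y. *)
Definition even_lines (c : nat) (z : int * int) : int * int :=
  let: (j, k) := z in
  match c with
  | 0 => (2 * j - k, j + 2 * k)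
  | 1 => (2 * j + k + 1, j - 2 * k)
  | 2 => (j - 2 * k, - 2 * j - k - 1)
  | 3 => (2 * k - j, 2 * j + k + 1)
  | _ => (- 2 * j - k - 1, 2 * k - j)
  end.

Definition even_lines_inv (c : nat) (z : int * int) : int * int :=
  let: (x, y) := z in
  match c with
  | 0 => (((2 * x + y) %/ 5)%Z, ((2 * y - x) %/ 5)%Z)
  | 1 => (((2 * x + y - 2) %/ 5)%Z, ((x - 2 * y - 1) %/ 5)%Z)
  | 2 => (((x - 2 * y - 2) %/ 5)%Z, ((- 2 * x - y - 1) %/ 5)%Z)
  | 3 => (((2 * y - x - 2) %/ 5)%Z, ((2 * x + y - 1) %/ 5)%Z)
  | _ => (((- 2 * x - y - 2) %/ 5)%Z, ((2 * y - x - 1) %/ 5)%Z)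
  end.

(** The exponent is now the norm x^2 + y^2 itself. On the ideal the sign (-1)^(x+y) equals
    (-1)^(j+k); on the other four cosets it is the opposite, whence the minus sign. *)
Lemma theta_gauss_sqr :
  theta (-1 : F) 1 1 ^+ 2 =
  theta (-1) 5 5 ^+ 2 - (ser_x F * (theta (-1) 9 1 * theta (-1) 7 3)) *+ 4.
Proof.
have p0 : locally_finite (texp 1 1) by apply: locally_finite_texp.
have p5 : locally_finite (texp 5 5) by apply: locally_finite_texp.
have p1 : locally_finite (texp 9 1) by apply: locally_finite_texp.
have p2 : locally_finite (texp 7 3) by apply: locally_finite_texp.
rewrite !expr2 /theta !thserM // -[ser_x F]expr1 ser_xn_thser -mulNrn -thserN; last first.
  move=> m; have [r er] := locally_finite_pair p1 p2 m; exists r => i /= le_m;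
    apply: er => /=; lia.
rewrite [LHS](@thser_partition F _ _ 5 (rot5 0) (fun c => even_lines c)
  (fun c => even_lines_inv c)); first last.
- move=> [x y]; have /= := rot5E 0 (x, y); move: (rot5 0 _) => [c /= lt_c5] E.
  move: c lt_c5 E => [|[|[|[|[|//]]]]] _ E; rewrite /even_lines_inv /even_lines; congr pair;
    lia.
- by move=> [[|[|[|[|[|//]]]]] lt_c5] [j k] /=; congr pair; lia.
- move=> c [j k]; apply: val_inj; have := rot5E 0 (even_lines c (j, k)).
  move: (rot5 0 _) => [d /= lt_d5].
  by case: c => [[|[|[|[|[|//]]]]] lt_c5] /=; lia.
- exact: locally_finite_pair.
have N1 : (-1 : F) != 0 by rewrite oppr_eq0 oner_eq0.
have sgn2 (x : int) : (-1 : F) ^ (x + x) = 1.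
  by rewrite expfzDr // -expfzMl mulrNN mulr1 exp1rz.
(* Parities are compared through an explicit t, which is supplied at each use. *)
have sgn_eq (x y u v t : int) : x + y + (t + t) = u + v ->
    (-1 : F) ^ x * (-1) ^ y = (-1) ^ u * (-1) ^ v.
  by move=> E; rewrite -!expfzDr // -E [RHS]expfzDr // sgn2 mulr1.
have sgn_opp (x y u v t : int) : x + y + (t + t) = u + v + 1 ->
    (-1 : F) ^ x * (-1) ^ y = - ((-1) ^ u * (-1) ^ v).
  move=> E; rewrite -!expfzDr //.
  transitivity ((-1 : F) ^ (x + y) * (-1) ^ (t + t)); first by rewrite sgn2 mulr1.
  by rewrite -expfzDr // E expfzDr // expr1z mulrN1.
have four (f : series F) : f *+ 4 = f + (f + (f + f)) by ring.
have E z : (texp 1 1 z)%:Z * 2 = 2 * (z * z) by rewrite texpE; ring.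
have E1 := texpE 9 1; have E2 := texpE 7 3.
rewrite !big_ord_recl big_ord0 addr0 four; congr (_ + _).
  apply: eq_thser => -[j k] /=; last by apply: (sgn_eq _ _ _ _ (- j)); lia.
  have := E (2 * j - k); have := E (j + 2 * k).
  have := texpE 5 5 j; have := texpE 5 5 k; nia.
congr (_ + (_ + (_ + _))); apply: eq_thser => -[j k] /=.
- move: (E1 j) (E2 k) (E (2 * j + k + 1)) (E (j - 2 * k)); nia.
- apply: (sgn_opp _ _ _ _ (k - j)); lia.
- move: (E1 j) (E2 k) (E (- 2 * j - k - 1)) (E (j - 2 * k)); nia.
- apply: (sgn_opp _ _ _ _ (j + k + k + 1)); lia.
- move: (E1 j) (E2 k) (E (2 * j + k + 1)) (E (2 * k - j)); nia.
- apply: (sgn_opp _ _ _ _ (- k)); lia.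
- move: (E1 j) (E2 k) (E (- 2 * j - k - 1)) (E (2 * k - j)); nia.
- apply: (sgn_opp _ _ _ _ (j + j + 1)); lia.
Qed.

End Quintic.

(** * Characteristic 3 *)

Section LinearFamilies.
Variables (R : comNzRingType) (I : choiceType) (e : I -> nat).
Hypothesis fin_e : locally_finite e.
Implicit Types w v : I -> R.

Lemma thserD w v : thser e (fun i => w i + v i) = thser e w + thser e v.
Proof.
apply/funext => m; have [r ur er] := locally_finiteE fin_e m.
have {}er i : e i = m -> i \in r by move=> E; apply: er; rewrite E.
by rewrite serD !(thserE _ ur er) big_split.
Qed.

Lemma thserMn w k : thser e (fun i => w i *+ k) = thser e w *+ k.
Proof.
elim: k => [|k IHk]; last by rewrite [RHS]mulrS -IHk -thserD; apply: eq_thser => // i;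
  rewrite mulrS.
by apply/funext => m; rewrite mulr0n -[RHS]/((0 : series R) m) ser0 /thser fsbig1.
Qed.

Lemma ser_D_thser w : ser_D (thser e w) = thser e (fun i => (e i)%:R * w i).
Proof.
apply/funext => m; have [r ur er] := locally_finiteE fin_e m.
have {}er i : e i = m -> i \in r by move=> E; apply: er; rewrite E.
rewrite /ser_D !(thserE _ ur er) big_distrr /=.
by apply: eq_bigr => i /eqP ->.
Qed.

End LinearFamilies.

Lemma ser_eqmX (R : comNzRingType) m (f g : series R) k :
  ser_eqm m f g -> ser_eqm m (f ^+ k) (g ^+ k).
Proof.
move=> E; elim: k => [|k IHk]; first by rewrite !expr0.
by rewrite !exprS; apply: ser_eqmM.
Qed.

(** That is, f(q)^p = f(q^p): Frobenius is additive and fixes the coefficients. Truncation reduces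
    this to polynomials. *)
Lemma ser_expFp (p : nat) (f : series 'F_p) n : prime p ->
  (f ^+ p) n = if (p %| n)%N then f (n %/ p)%N else 0.
Proof.
move=> p_pr; have p_gt0 := prime_gt0 p_pr.
have E : ser_eqm n f (ser_poly (ser_trunc f n)).
  by move=> i le_in; rewrite -(coef_ser_trunc f le_in).
rewrite (ser_eqmX p E (leqnn n)) -rmorphXn -[LHS]/((ser_trunc f n ^+ p)`_n).
have chP : p \in [pchar {poly 'F_p}] by rewrite pchar_poly pchar_Fp.
rewrite /ser_trunc poly_def -(pFrobenius_autE chP) rmorph_sum coef_sum /=.
have Fr (i : 'I_n.+1) : pFrobenius_aut chP (f i *: 'X^i) = f i *: 'X^(i * p).
  rewrite pFrobenius_autE exprZn -exprM; congr (_ *: _).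
  by have := expf_card (f i); rewrite card_Fp.
under eq_bigr do rewrite Fr coefZ coefXn.
case: ifP => [/dvdnP[k ->]|ndiv].
  have lt_k : (k < (k * p).+1)%N by rewrite ltnS leq_pmulr.
  rewrite mulnK // (bigD1 (Ordinal lt_k)) //= eqxx mulr1 big1 ?addr0 // => i.
  rewrite -val_eqE /= eqn_pmul2r // eq_sym => /negbTE ->; exact: mulr0.
rewrite big1 // => i _; have [E1|_] := eqVneq n (i * p)%N; last by rewrite mulr0.
by case/negP: (negbT ndiv); rewrite E1 dvdn_mull.
Qed.

Lemma thser_expFp (p : nat) (I : choiceType) (e : I -> nat) (w : I -> 'F_p) :
  prime p -> thser e w ^+ p = thser (fun i => (p * e i)%N) w.
Proof.
move=> p_pr; have p_gt0 := prime_gt0 p_pr.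
apply/funext => n; rewrite ser_expFp //.
case: ifP => [/dvdnP[k ->]|ndiv].
  rewrite mulnK //; apply: eq_fsbigl; apply/seteqP; split=> i /=; nia.
by rewrite /thser fsbig1 // => i /= E; move: ndiv; rewrite -E dvdn_mulr.
Qed.

Lemma three_F3 : (3%:R : 'F_3) = 0. Proof. by apply/val_inj. Qed.
Lemma natF3 m : (m%:R : 'F_3) = (m %% 3)%:R.
Proof. by rewrite {1}(divn_eq m 3) natrD natrM three_F3 mulr0 add0r. Qed.

Lemma theta_exp9 (s : 'F_3) al be :
  theta s al be ^+ 9 = thser (fun n => (9 * texp al be n)%N) (fun n => s ^ n).
Proof.
rewrite (exprM _ 3 3) /theta !thser_expFp //.
by apply: eq_thser => // n; lia.
Qed.

(** Modulo 3, n^2 is 1 unless 3 divides n, and the terms with 3 dividing n form the series in q^9,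
    that is, the ninth power. *)
Lemma ser_D_theta_gauss k : (0 < k)%N ->
  ser_D (theta (-1 : 'F_3) k k) = (theta (-1) k k - theta (-1) k k ^+ 9) *+ k.
Proof.
move=> k_gt0; have fin : locally_finite (texp k k) by apply: locally_finite_texp; lia.
have E9 : theta (-1 : 'F_3) k k ^+ 9 =
    thser (texp k k) (fun n => if (n %% 3 == 0)%Z then (-1) ^ n else 0).
  rewrite (@thser_inj _ _ _ _ _ (fun n => 3 * n) (fun n => (n %/ 3)%Z)); try by [move=> *; lia].
  rewrite theta_exp9; apply: eq_thser => n /=.
    by have := texpE k k n; have := texpE k k (3 * n); nia.
  by rewrite -exprz_exp [_ ^ 3](_ : _ = -1) //; apply/val_inj.
rewrite mulrnBl ser_D_thser // E9; apply/eqP; rewrite -subr_eq opprK; apply/eqP.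
rewrite -!thserMn // -thserD //; apply: eq_thser => // n.
have -> : ((texp k k n)%:R : 'F_3) = ((absz n ^ 2)%N%:R) *+ k.
  have -> : texp k k n = (absz n ^ 2 * k)%N by have := texpE k k n; nia.
  by rewrite natrM mulr_natr.
rewrite mulrnAl -mulrnDl; congr (_ *+ k); rewrite natF3.
case: eqP => [n0|n0].
  have -> : (absz n ^ 2 %% 3 = 0)%N by nia.
  by rewrite mul0r add0r.
have -> : (absz n ^ 2 %% 3 = 1)%N by nia.
by rewrite mul1r addr0.
Qed.

(** Modulo 3, n(n+1)/2 is 1 if n = 1 and 0 otherwise; moreover tri(3n+1) = 9 tri(n) + 1. *)
Lemma ser_D_theta_triangular k : (0 < k)%N ->
  ser_D (theta (1 : 'F_3) k 0) = (ser_x _ ^+ k * theta 1 k 0 ^+ 9) *+ k.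
Proof.
move=> k_gt0; have fin : locally_finite (texp k 0) by apply: locally_finite_texp; lia.
have E9 : ser_x _ ^+ k * theta (1 : 'F_3) k 0 ^+ 9 =
    thser (texp k 0) (fun n => if (n %% 3 == 1)%Z then 1 else 0).
  rewrite (@thser_inj _ _ _ _ _ (fun n => 3 * n + 1) (fun n => ((n - 1) %/ 3)%Z));
    try by [move=> *; lia].
  rewrite theta_exp9 ser_xn_thser; apply: eq_thser => n /=; last by rewrite exp1rz.
  have E z : (texp k 0 z)%:Z * 2 = k%:Z * (z * z + z) by rewrite texpE; ring.
  have := E (3 * n + 1).
  have -> : k%:Z * ((3 * n + 1) * (3 * n + 1) + (3 * n + 1)) = 9 * (k%:Z * (n * n + n)) +
    2 * k%:Z by ring.
  rewrite -E; move: (texp k 0 n) (texp k 0 (3 * n + 1)) => T T'; clear -T; lia.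
rewrite ser_D_thser // E9 -thserMn //; apply: eq_thser => // n.
have -> : ((texp k 0 n)%:R : 'F_3) = ((tri n)%:R) *+ k.
  by rewrite /texp addn0 mulnC natrM mulr_natr.
rewrite exp1rz mulr1; congr (_ *+ k); rewrite natF3.
have := triE n; case: eqP => n1.
  have -> : n = 3 * (n %/ 3)%Z + 1 by lia.
  by move: (n %/ 3)%Z (tri _) => m t E; have -> : (t %% 3 = 1)%N by nia.
have [->|->] : n = 3 * (n %/ 3)%Z \/ n = 3 * (n %/ 3)%Z + 2 by lia.
  by move: (n %/ 3)%Z (tri _) => m t E; have -> : (t %% 3 = 0)%N by nia.
by move: (n %/ 3)%Z (tri _) => m t E; have -> : (t %% 3 = 0)%N by nia.
Qed.

(** * The differential equation for g *)

Section DerivationIdentity.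
Variables (R : comNzRingType) (D : R -> R).
Hypotheses (char3 : 3%:R = 0 :> R).
Hypotheses (DD : forall x y, D (x + y) = D x + D y) (DN : forall x, D (- x) = - D x).
Hypothesis DM : forall x y, D (x * y) = D x * y + x * D y.
Hypothesis DX : forall x n, D (x ^+ n.+1) = n.+1%:R * x ^+ n * D x.
(** Here a and c stand for phi(q) and phi(q^5), b and d for psi(q) and psi(q^5), and e1, e2, e5, e10
    for the f_k. In [Dc] and [Dd] the factor 5 has become -1. *)
Variables (q a b c d p p' u g e1 e2 e5 e10 : R).
Hypotheses (Dq : D q = q) (Da : D a = a - a ^+ 9) (Db : D b = q * b ^+ 9).
Hypotheses (Dc : D c = c ^+ 9 - c) (Dd : D d = - (q ^+ 5 * d ^+ 9)).
Hypotheses (Ea : a * e2 = e1 ^+ 2) (Eb : b * e1 = e2 ^+ 2).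
Hypotheses (Ec : c * e10 = e5 ^+ 2) (Ed : d * e5 = e10 ^+ 2).
Hypotheses (Ep : p * e1 * e10 = e2 * e5 ^+ 3) (Ep' : p' * e2 * e5 = e1 * e10 ^+ 3).
Hypotheses (Eb2 : b ^+ 2 = q * d ^+ 2 + p) (Ea2 : a ^+ 2 = c ^+ 2 - q * p').
Hypotheses (Eg : g * e1 ^+ 3 * e10 = e2 * e5) (Eu : u * p = q * d ^+ 2).
Hypotheses (re1 : GRing.lreg e1) (re2 : GRing.lreg e2) (re5 : GRing.lreg e5).
Hypotheses (re10 : GRing.lreg e10) (ra : GRing.lreg a) (rb : GRing.lreg b).
Hypotheses (rc : GRing.lreg c) (rd : GRing.lreg d) (rp : GRing.lreg p).
Hypothesis rS : GRing.lreg ((1 - u) ^+ 5 + u * (1 + u) ^+ 5).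

(** A cube, hence killed by D; differentiating it gives [qb8]. The same holds for [c2d] and
    [qd8]. *)
Let a2b : a ^+ 2 * b = e1 ^+ 3.
Proof.
have r : GRing.lreg (e2 ^+ 2 * e1) by apply: lregM => //; apply: lregX.
apply: r; transitivity ((a * e2) ^+ 2 * (b * e1)); first by ring.
by rewrite Ea Eb; ring.
Qed.

Let c2d : c ^+ 2 * d = e5 ^+ 3.
Proof.
have r : GRing.lreg (e10 ^+ 2 * e5) by apply: lregM => //; apply: lregX.
apply: r; transitivity ((c * e10) ^+ 2 * (d * e5)); first by ring.
by rewrite Ec Ed; ring.
Qed.

Let D_cube x : D (x ^+ 3) = 0.
Proof. by rewrite DX char3 !mul0r. Qed.

Let qb8 : q * b ^+ 8 = 1 - a ^+ 8.
Proof.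
have r : GRing.lreg (a ^+ 2 * b) by apply: lregM => //; apply: lregX.
have E : 2 * (1 - a ^+ 8) + q * b ^+ 8 = 0.
  apply: r; rewrite mulr0 -(D_cube e1) -a2b DM DX Da Db expr1; ring.
transitivity (2 * (1 - a ^+ 8) + q * b ^+ 8 - 3%:R * (1 - a ^+ 8) + (1 - a ^+ 8));
  first by ring.
by rewrite E char3; ring.
Qed.

Let qd8 : q ^+ 5 * d ^+ 8 = 1 - c ^+ 8.
Proof.
have r : GRing.lreg (c ^+ 2 * d) by apply: lregM => //; apply: lregX.
have E : 2 * (1 - c ^+ 8) + q ^+ 5 * d ^+ 8 = 0.
  apply: r; rewrite mulr0 -(oppr0 R) -(D_cube e5) -c2d DM DX Dc Dd expr1; ring.
transitivity (2 * (1 - c ^+ 8) + q ^+ 5 * d ^+ 8 - 3%:R * (1 - c ^+ 8) + (1 - c ^+ 8));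
  first by ring.
by rewrite E char3; ring.
Qed.

Let b2 : b ^+ 2 = p * (1 + u).
Proof. by rewrite Eb2 -Eu; ring. Qed.

(** The relation p p' = (c d)^2 removes p' from the level 10 relation for a^2. *)
Let a2 : a ^+ 2 = c ^+ 2 * (1 - u).
Proof.
have pp' : p * p' = c ^+ 2 * d ^+ 2.
  have r : GRing.lreg (e1 * e2 * e5 ^+ 2 * e10 ^+ 2) by do ![apply: lregM | apply: lregX |
    done].
  apply: r; transitivity ((p * e1 * e10) * (p' * e2 * e5) * (e5 * e10)); first by ring.
  transitivity ((c * e10) ^+ 2 * (d * e5) ^+ 2 * e1 * e2); last by ring.
  by rewrite Ep Ep' Ec Ed; ring.
apply: rp; transitivity (p * c ^+ 2 - q * (p * p')); first by rewrite Ea2; ring.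
by rewrite pp'; transitivity (c ^+ 2 * (p - q * d ^+ 2)); [ring | rewrite -Eu; ring].
Qed.

Let a8 : a ^+ 8 = c ^+ 8 * (1 - u) ^+ 4.
Proof. by rewrite (exprM a 2 4) a2; ring. Qed.

Let p3a : p ^+ 3 * a = b * d * c ^+ 5.
Proof.
have r : GRing.lreg (e1 ^+ 3 * e10 ^+ 5 * e2 * e5) by do ![apply: lregM | apply: lregX | done].
apply: r; transitivity ((p * e1 * e10) ^+ 3 * (a * e2) * e10 ^+ 2 * e5); first by ring.
transitivity ((b * e1) * (d * e5) * (c * e10) ^+ 5 * e1 ^+ 2 * e2); last by ring.
by rewrite Ep Ea Eb Ec Ed; ring.
Qed.

(** Obtained by squaring [p3a] and eliminating a^2, b^2 and q d^2. *)
Let qp4 : q * p ^+ 4 * (1 - u) = u * (1 + u) * c ^+ 8.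
Proof.
have r : GRing.lreg (p ^+ 2 * c ^+ 2) by do ![apply: lregM | apply: lregX | done].
apply: r; transitivity (q * p ^+ 6 * a ^+ 2); first by rewrite a2; ring.
transitivity (q * (p ^+ 3 * a) ^+ 2); first by ring.
transitivity (b ^+ 2 * (q * d ^+ 2) * c ^+ 10); first by rewrite p3a; ring.
by rewrite b2 -Eu; ring.
Qed.

(** This is a^8 + q b^8 = 1 in terms of u and c^8; it makes c^8 a rational function of u. *)
Let S_c8 : c ^+ 8 * ((1 - u) ^+ 5 + u * (1 + u) ^+ 5) = 1 - u.
Proof.
transitivity ((1 - u) * (a ^+ 8 + q * b ^+ 8)); last by rewrite qb8; ring.
rewrite a8 (exprM b 2 4) b2.
transitivity ((1 - u) ^+ 5 * c ^+ 8 + (1 + u) ^+ 4 * (u * (1 + u) * c ^+ 8)); first by ring.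
by rewrite -qp4; ring.
Qed.

(** The logarithmic derivative D p / p. *)
Let la := 2 * (1 + u) * (1 - c ^+ 8 * (1 - u) ^+ 4) - u + 2 * u * (1 - c ^+ 8).

Let Dp : D p = p * la.
Proof.
have E : p = b ^+ 2 - q * d ^+ 2 by rewrite Eb2; ring.
rewrite {1}E DD DN (DM q) !DX Db Dd Dq !expr1 /la -a8.
transitivity (2 * b ^+ 2 * (q * b ^+ 8) - q * d ^+ 2 + 2 * (q * d ^+ 2) * (q ^+ 5 * d ^+ 8));
  first by ring.
by rewrite qb8 qd8 b2 -Eu; ring.
Qed.

(** The logarithmic derivative D g / g. *)
Let V := c ^+ 8 * (u ^+ 2 - u ^+ 3 - u ^+ 4 - u ^+ 5).

(** Up to cubes g is p^2 a / c, so D g / g = 2 D p / p + D a / a - D c / c. *)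
Let Dg : D g = g * V.
Proof.
have E : (e1 * e5) ^+ 3 * (g * c) = p ^+ 2 * a.
  have r : GRing.lreg (e1 ^+ 2 * e2 * e10 ^+ 2) by do ![apply: lregM | apply: lregX | done].
  apply: r; transitivity ((g * e1 ^+ 3 * e10) * (c * e10) * e5 ^+ 3 * e1 ^+ 2 * e2);
    first by ring.
  transitivity ((p * e1 * e10) ^+ 2 * (a * e2)); last by ring.
  by rewrite Eg Ec Ep Ea; ring.
have r : GRing.lreg ((e1 * e5) ^+ 3 * c) by do ![apply: lregM | apply: lregX | done].
have := congr1 D E; rewrite (DM (_ ^+ 3)) D_cube mul0r add0r (DM g) (DM (p ^+ 2)) DX Dp Da Dc
  expr1 => E'.
apply: r.
transitivity ((e1 * e5) ^+ 3 * (D g * c + g * (c ^+ 9 - c)) + (e1 * e5) ^+ 3 * (g * c) *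
  (1 - c ^+ 8)); first by ring.
rewrite E' E.
transitivity (p ^+ 2 * a * (2 * la + 1 - a ^+ 8 + 1 - c ^+ 8)); first by ring.
transitivity (p ^+ 2 * a * V); last by rewrite -E; ring.
congr (_ * _); rewrite a8 /la /V; apply/eqP; rewrite -subr_eq0; apply/eqP.
(* The two sides differ by 3 times this integer polynomial. *)
transitivity (3%:R * (2 + 2 * u - 2 * c ^+ 8 + 4 * c ^+ 8 * u - 5 * c ^+ 8 * u ^+ 2
  - c ^+ 8 * u ^+ 3 + 4 * c ^+ 8 * u ^+ 4 - c ^+ 8 * u ^+ 5)); first by ring.
by rewrite char3 mul0r.
Qed.

Let Du : D u = 2 * (1 - u) * (c ^+ 8 + a ^+ 8 - 2).
Proof.
have r : GRing.lreg (c ^+ 2) by apply: lregX.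
have E : a ^+ 2 + c ^+ 2 * u = c ^+ 2 by rewrite a2; ring.
have := congr1 D E; rewrite DD DM !DX Da Dc !expr1 => E'.
apply: r; transitivity (2 * c * (c ^+ 9 - c) - 2 * a * (a - a ^+ 9) - 2 * c * (c ^+ 9 - c) * u).
  by rewrite -[X in X - _ - _]E'; ring.
transitivity (2 * c ^+ 2 * (c ^+ 8 - 1) * (1 - u) - 2 * a ^+ 2 * (1 - a ^+ 8)); first by ring.
by rewrite a2; ring.
Qed.

(* V^2 + DV + V has the form C (C K2 + K1) with C = c^8 and K1, K2 in Z[u]; since
   C S = 1 - u for S = (1 - u)^5 + u (1 + u)^5, [key] amounts to
   (1 - u) K2 + S K1 = 0 mod 3. *)
Lemma derivation_identity : D (D g) + D g = q ^+ 4 * d ^+ 6.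
Proof.
have DV : D V = 8 * c ^+ 8 * (c ^+ 8 - 1) * (u ^+ 2 - u ^+ 3 - u ^+ 4 - u ^+ 5)
   + c ^+ 8 * (2 * u - 3 * u ^+ 2 - 4 * u ^+ 3 - 5 * u ^+ 4)
     * (2 * (1 - u) * (c ^+ 8 + c ^+ 8 * (1 - u) ^+ 4 - 2)).
  by rewrite /V DM !DD !DN !DX Dc Du a8; ring.
have key : V ^+ 2 + D V + V = c ^+ 8 * u ^+ 4 * (1 + u).
  apply/eqP; rewrite -subr_eq0; apply/eqP/rS; rewrite mulr0 DV /V.
  (* The last polynomial is the coefficient of c^16 in V^2 + D V + V; once c^8 S is traded for 1 -
     u, the remainder is divisible by 3. *)
  transitivity (3%:R * (c ^+ 8 * (3 * u ^+ 2 - 27 * u ^+ 3 + 10 * u ^+ 4 + 40 * u ^+ 5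
      + 88 * u ^+ 6 + 40 * u ^+ 7 + 34 * u ^+ 8 - 36 * u ^+ 9 - 19 * u ^+ 10 - 5 * u ^+ 11))
    + (c ^+ 8 * ((1 - u) ^+ 5 + u * (1 + u) ^+ 5) - (1 - u)) * c ^+ 8
      * (8 * u - 28 * u ^+ 2 + 52 * u ^+ 3 - 79 * u ^+ 4 + 50 * u ^+ 5 - 55 * u ^+ 6
         + 66 * u ^+ 7 - 39 * u ^+ 8 + 12 * u ^+ 9 + u ^+ 10)); first by ring.
  by rewrite char3 S_c8 subrr !mul0r addr0.
(* This product of f_k will trade g c^8 b^2 d^8 for p^5 d^6, which removes g from the right side. *)
have gc8 : g * c ^+ 8 * d ^+ 2 * b ^+ 2 = p ^+ 5.
  have r : GRing.lreg (e1 ^+ 5 * e10 ^+ 9 * e5 ^+ 2) by do ![apply: lregM | apply: lregX |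
    done].
  apply: r.
  transitivity ((g * e1 ^+ 3 * e10) * (c * e10) ^+ 8 * (d * e5) ^+ 2 * (b * e1) ^+ 2);
    first by ring.
  transitivity ((p * e1 * e10) ^+ 5 * e10 ^+ 4 * e5 ^+ 2); last by ring.
  by rewrite Eg Ec Ed Eb Ep; ring.
have r : GRing.lreg (p ^+ 5) by apply: lregX.
apply: r; rewrite Dg DM Dg.
transitivity (p ^+ 5 * g * (V ^+ 2 + D V + V)); first by ring.
rewrite key; transitivity (g * c ^+ 8 * (u * p) ^+ 4 * (p * (1 + u))); first by ring.
by rewrite Eu -b2 -gc8; ring.
Qed.

End DerivationIdentity.

(** * Reduction of the generating function modulo 3 *)

Section Reduction.
Variable F : fieldType.

Definition red (f : nat -> int) : series F := fun n => (f n)%:~R.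

Lemma redM f g : red (fps_mul f g) = red f * red g.
Proof.
apply/funext => n; rewrite serM /red /fps_mul rmorph_sum.
by apply: eq_bigr => i _; rewrite rmorphM.
Qed.

Lemma red_qpoch (a b : {poly int}) :
  red (qpoch a b) = pprod (map_poly intr a) (map_poly intr b).
Proof.
apply/funext => n; rewrite /red /qpoch /pprod.
suff <- : map_poly intr (\prod_(j < n.+1) (1 - a * b ^+ j)) =
  \prod_(j < n.+1) (1 - map_poly intr a * map_poly intr b ^+ j) :> {poly F} by rewrite coef_map.
by rewrite rmorph_prod; apply: eq_bigr => i _; rewrite rmorphB rmorph1 rmorphM rmorphXn.
Qed.

(** Each (-q^k;q^k)_oo is f_2k / f_k; denominators are then cleared. *)
Lemma red_Delta2 : red Delta2 * euler F 1 ^+ 3 * euler F 10 = euler F 2 * euler F 5.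
Proof.
have := Delta2_gf => /funext /(congr1 red); rewrite !redM !red_qpoch.
rewrite !rmorphN /= !map_polyX !map_polyXn -/(euler F 1) => E.
rewrite -(pprodN_euler F (isT : 0 < 5)%N) -(pprodN_euler F (isT : 0 < 1)%N) -[pprod (- 'X^1)
  _]E.
ring.
Qed.

End Reduction.

Lemma serM0 (R : comNzRingType) (f g : series R) : (f * g) 0%N = f 0%N * g 0%N.
Proof. by rewrite serM big_ord1. Qed.

Lemma serX0 (R : comNzRingType) (f : series R) k : f 0%N = 1 -> (f ^+ k) 0%N = 1.
Proof.
by move=> f0; elim: k => [|k IHk]; rewrite ?expr0 ?ser1 // exprS serM0 f0 IHk mulr1.
Qed.

Lemma ser_lreg (R : comNzRingType) (f : series R) : f 0%N = 1 -> GRing.lreg f.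
Proof. by move=> f0 g h; apply: ser_cancel. Qed.

(** The right side is displayed as a cube so that [ser_expFp] can read its coefficients. *)
Lemma Delta2_derivation (g := red 'F_3 Delta2) :
  ser_D (ser_D g) + ser_D g = ser_x _ ^+ 4 * (theta 1 5 0 ^+ 2) ^+ 3.
Proof.
have char3 : (3%:R : series 'F_3) = 0.
  have -> : (3%:R : series 'F_3) = ser_poly 3%:R by rewrite rmorph_nat.
  by rewrite -polyC_natr three_F3 polyC0 rmorph0.
have e0 k : (0 < k)%N -> euler 'F_3 k 0%N = 1 by apply: euler0.
(* Since 2 = -1 in F_3, psi is minus the theta series that equals 2 psi. *)
pose a := theta (-1 : 'F_3) 1 1; pose b := - theta (1 : 'F_3) 1 0.
pose c := theta (-1 : 'F_3) 5 5; pose d := - theta (1 : 'F_3) 5 0.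
pose p := theta (1 : 'F_3) 1 4 * theta 1 3 2.
pose p' := theta (-1 : 'F_3) 9 1 * theta (-1) 7 3.
have Ea : a * euler _ 2 = euler _ 1 ^+ 2 by apply: theta_gauss.
have Ec : c * euler _ 10 = euler _ 5 ^+ 2 by apply: theta_gauss.
have Eb' k : (0 < k)%N -> (- theta (1 : 'F_3) k 0) * euler _ k = euler _ (2 * k) ^+ 2.
  move=> k0; rewrite mulNr theta_triangular //.
  transitivity (euler 'F_3 (2 * k) ^+ 2 - 3%:R * euler _ (2 * k) ^+ 2); first by ring.
  by rewrite char3 mul0r subr0.
have Eb : b * euler _ 1 = euler _ 2 ^+ 2 by apply: Eb'.
have Ed : d * euler _ 5 = euler _ 10 ^+ 2 by apply: Eb'.
have Ep : p * euler _ 1 * euler _ 10 = euler _ 2 * euler _ 5 ^+ 3 by apply: theta_quintic1.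
have Ep' : p' * euler _ 2 * euler _ 5 = euler _ 1 * euler _ 10 ^+ 3 by apply: theta_quintic2.
have q1 (x y : series 'F_3) k : y 0%N = 1 -> x * y = k -> k 0%N = 1 -> x 0%N = 1.
  by move=> y0 E; rewrite -E serM0 y0 mulr1.
have a0 : a 0%N = 1 by apply: q1 Ea _; rewrite ?serX0 ?e0.
have b0 : b 0%N = 1 by apply: q1 Eb _; rewrite ?serX0 ?e0.
have c0 : c 0%N = 1 by apply: q1 Ec _; rewrite ?serX0 ?e0.
have d0 : d 0%N = 1 by apply: q1 Ed _; rewrite ?serX0 ?e0.
have p0 : p 0%N = 1.
  by rewrite -mulrA in Ep; apply: q1 Ep _; rewrite !serM0 ?serX0 ?e0 ?mulr1.
pose u := ser_x _ * d ^+ 2 * ser_inv p.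
(* Hence (1 - u)^5 + u (1 + u)^5 has constant term 1 and can be cancelled. *)
have u0 : u 0%N = 0.
  by rewrite /u serM0 serM0 -[ser_x _]mulr1 -[ser_x _]expr1 ser_xnM !mul0r.
have -> : theta (1 : 'F_3) 5 0 ^+ 2 = d ^+ 2 by rewrite sqrrN.
rewrite -exprM.
apply: (@derivation_identity _ (@ser_D _) char3 (@ser_DD _) (@ser_DN _) (@ser_DM _)
  (@ser_DX _) _ a b c d p p' u g (euler _ 1) (euler _ 2) (euler _ 5) (euler _ 10)) => //;
  try (by apply: ser_lreg; rewrite ?e0); try exact: ser_Dx.
- by rewrite ser_D_theta_gauss.
- by rewrite /b ser_DN ser_D_theta_triangular // expr1 mulr1n; ring.
- rewrite ser_D_theta_gauss // -/c.
  transitivity (c ^+ 9 - c + 3%:R * (2 * (c - c ^+ 9))); first by ring.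
  by rewrite char3 mul0r addr0.
- rewrite /d ser_DN ser_D_theta_triangular //.
  set t := theta _ _ _.
  transitivity (- (ser_x _ ^+ 5 * (- t) ^+ 9) - 3%:R * (2 * (ser_x _ ^+ 5 * t ^+ 9)));
    first by ring.
  by rewrite char3 mul0r subr0.
- rewrite /b /d /p !sqrrN theta_triangular_sqr; set t := theta _ _ _ * _.
  transitivity (ser_x _ * theta (1 : 'F_3) 5 0 ^+ 2 + t + 3%:R * t); first by ring.
  by rewrite char3 mul0r addr0.
- rewrite /a /c /p' theta_gauss_sqr; set t := theta _ _ _ * _.
  transitivity (theta (-1 : 'F_3) 5 5 ^+ 2 - ser_x _ * t - 3%:R * (ser_x _ * t)); first by ring.
  by rewrite char3 mul0r subr0.
- exact: red_Delta2.
- transitivity (ser_x 'F_3 * d ^+ 2 * (ser_inv p * p)); first by rewrite /u; ring.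
  by rewrite ser_mulVr // mulr1.
- apply: ser_lreg; rewrite serD serM0 u0 mul0r addr0 serX0 //.
  by rewrite serD serN u0 subr0 ser1.
Qed.

(** At q^(3m+1) the operator D^2 + D multiplies by 2, which is invertible modulo 3. By Frobenius the
    right side there is the coefficient of q^(m-1) in the square of the theta series of q^5. *)
Lemma Delta2_eq0 m :
  (forall i j : int, 5 * (tri i + tri j) + 1 != m)%N -> (Delta2 (3 * m + 1) = 0 %[mod 3])%Z.
Proof.
move=> no_rep; apply/eqP; rewrite eqz_mod_dvd subr0 (dvdz_pcharf (pchar_Fp _)) //.
have := congr1 (fun f : series 'F_3 => f (3 * m + 1)%N) Delta2_derivation.
rewrite serD ser_xnM /ser_D -[red _ _ _]/((Delta2 (3 * m + 1))%:~R : 'F_3).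
rewrite mulrA -mulrDl -natrM -natrD natF3.
have -> : (((3 * m + 1) * (3 * m + 1) + (3 * m + 1)) %% 3 = 2)%N by nia.
(* For m = 0 the factor q^4 makes the right side vanish. *)
case: ltnP => [_|le4 E].
  by move=> /eqP; rewrite mulf_eq0.
have : (2%:R : 'F_3) * (Delta2 (3 * m + 1))%:~R == 0; last by rewrite mulf_eq0.
have Em : (3 * m + 1 - 4 = (m - 1) * 3)%N by lia.
rewrite E Em ser_expFp // dvdn_mull // mulnK //.
have fin : locally_finite (texp 5 0) by apply: locally_finite_texp.
rewrite expr2 /theta thserM // /thser fsbig1 // => -[i j] /= Eij.
have := no_rep i j; rewrite /texp in Eij; lia.
Qed.

(** * Sums of two squares and the arithmetic progressions *)

Lemma dvd3_sum_two_squares (x y : int) :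
  (3 %| x * x + y * y)%Z -> (3 %| x)%Z /\ (3 %| y)%Z.
Proof.
have mod3 (z : int) : exists u r : int, z = u * 3 + r /\ (r = 0 \/ r = 1 \/ r = 2).
  by exists (z %/ 3)%Z, (z %% 3)%Z; lia.
have [u [r [-> Er]]] := mod3 x; have [v [s [-> Es]]] := mod3 y.
have -> : (u * 3 + r) * (u * 3 + r) + (v * 3 + s) * (v * 3 + s)
   = 3 * (3 * u * u + 2 * u * r + 3 * v * v + 2 * v * s) + (r * r + s * s) by ring.
move: (_ + _ + _ + _) => w.
by case: Es => [->|[->|->]]; case: Er => [->|[->|->]]; lia.
Qed.

(** Descent: as 3 divides x^2 + y^2, it divides x and y, and a factor 9 is removed. At k = 0 the
    left side is divisible by 9 while 6 supplies a single 3. *)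
Lemma sum_two_squares_val3 k (x y : int) (M : nat) :
  5 * (x * x + y * y) = (2 * 3 * 9 ^ k * M)%N -> (3 %| M)%N.
Proof.
elim: k x y => [|k IHk] x y E.
  have [] := @dvd3_sum_two_squares x y; first by lia.
  case/dvdzP=> x' Ex /dvdzP[y' Ey]; move: E; rewrite Ex Ey.
  have -> : x' * 3 * (x' * 3) + y' * 3 * (y' * 3) = 9 * (x' * x' + y' * y') by ring.
  by move: (_ + _) => w; lia.
have [] := @dvd3_sum_two_squares x y.
  by move: E; rewrite -!mulnA; move: (9 ^ _ * M)%N (x * x + y * y) => W w; lia.
case/dvdzP=> x' Ex /dvdzP[y' Ey]; apply: (IHk x' y'); move: E; rewrite Ex Ey expnS.
have -> : x' * 3 * (x' * 3) + y' * 3 * (y' * 3) = 9 * (x' * x' + y' * y') by ring.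
have -> : (2 * 3 * (9 * 9 ^ k) * M = 9 * (2 * 3 * 9 ^ k * M))%N by ring.
by move: (_ * M)%N (x' * x' + y' * y') => W w; lia.
Qed.

Lemma Delta2_mod3 k n s : (0 < s < 3)%N ->
  (Delta2 (3 ^ (2 * k.+1 + 1) * n + (3 * (3 ^ (2 * k.+1) - 1)) %/ 4
           + s * 3 ^ (2 * k.+1) + 1)%N = 0 %[mod 3])%Z.
Proof.
move=> s_bound; rewrite expnD expn1 expnM expnS.
have E9 : (3 ^ 2 = 9)%N by []. rewrite E9.
(* This makes the division by 4 exact, with quotient 27 r + 6. *)
have [r Er] : exists r, (9 ^ k = 4 * r + 1)%N.
  by elim: k => [|k [r IHr]]; [exists 0%N | exists (9 * r + 2)%N; rewrite expnS; lia].
set N := (X in Delta2 X).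
have -> : N = (3 * (9 * 9 ^ k * n + 9 * r + 2 + 3 * s * 9 ^ k) + 1)%N.
  rewrite /N; have -> : (3 * (9 * 9 ^ k - 1) %/ 4 = 27 * r + 6)%N by rewrite Er; lia.
  by move: (9 ^ k)%N => T; lia.
set m := (9 * 9 ^ k * n + 9 * r + 2 + 3 * s * 9 ^ k)%N; apply: Delta2_eq0 => i j;
  apply/eqP => E.
(* A representation of m gives 5 ((2i+1)^2 + (2j+1)^2) = 8m + 2 = 6 * 9^k (12 n + 3 + 4 s), whose
   3-adic valuation would be odd. *)
have [] : ~ (3 %| 12 * n + 3 + 4 * s)%N by lia.
apply: (@sum_two_squares_val3 k (2 * i + 1) (2 * j + 1)).
have := triE i; have := triE j; move: (tri i) (tri j) E => ti tj E Ej Ei.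
transitivity (5 * (4 * (tj%:Z * 2) + 4 * (ti%:Z * 2) + 2)); first by rewrite Ej Ei; ring.
have -> : (2 * 3 * 9 ^ k * (12 * n + 3 + 4 * s) = 6 * (12 * (9 ^ k * n) +
  3 * 9 ^ k + 4 * (s * 9 ^ k)))%N by ring.
have : (m = 9 * (9 ^ k * n) + 9 * r + 2 + 3 * (s * 9 ^ k))%N by rewrite /m; ring.
rewrite -E.
by move: (9 ^ k * n)%N (9 ^ k)%N (s * 9 ^ k)%N Er => A B C; lia.
Qed.

Theorem theorem1p1 (l n : nat) (hl : (1 <= l)%N) :
  (Delta2 (3 ^ (2 * l + 1) * n + (3 * (3 ^ (2 * l) - 1)) %/ 4
           + 3 ^ (2 * l) + 1)%N = 0 %[mod 3])%Z /\
  (Delta2 (3 ^ (2 * l + 1) * n + (3 * (3 ^ (2 * l) - 1)) %/ 4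
           + 2 * 3 ^ (2 * l) + 1)%N = 0 %[mod 3])%Z.
Proof.
case: l hl => // k _; split; last exact: Delta2_mod3.
by have := @Delta2_mod3 k n 1; rewrite mul1n; apply.
Qed.
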